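(* Let $1\le j\le n$ and let $F=\{x_1,\dots,x_j\}$ be a partition of $[n]$ into $j$ blocks all of size at least $2$. Choose elements $s_i\in x_i$ and set $x_i^{1}=x_i$, $x_i^{-1}=\{s_i\}$. Let $HO(F)=\{\{x_1^{\epsilon_1},\dots,x_j^{\epsilon_j}\} : (\epsilon_1,\dots,\epsilon_j)\in\{-1,1\}^j\}$, and let $\sigma_F$ be the $(j-1)$-chain of $D_n$ given by the sum of the faces in $HO(F)$ (with coherent orientations). Then each $\sigma_F$ is a $(j-1)$-cycle which is (combinatorially) the boundary of a $j$-dimensional cross-polytope, and the classes $[\sigma_F]$, as $F$ ranges over all partitions of $[n]$ into exactly $j$ blocks with no singleton block, form a basis of $\widetilde{H}_{j-1}(D_n)$.
   Context: $[n]=\{1,\dots,n\}$. A partial partition of $[n]$ is a set of pairwise disjoint nonempty subsets (blocks) of $[n]$. $D_n$ is the abstract simplicial complex whose vertices are the nonempty subsets of $[n]$ and whose faces are the partial partitions of $[n]$. $\widetilde{H}_\ast$ denotes reduced simplicial homology with integer coefficients. A singleton block is a block of size $1$. *)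

(* Defs.v *)
From HB Require Import structures.
From mathcomp Require Import all_boot all_order all_algebra.
From mathcomp Require Import generic_quotient ring_quotient boolp.

Set Implicit Arguments.
Unset Strict Implicit.
Unset Printing Implicit Defensive.

Import Order.TTheory GRing.Theory Num.Theory.

Local Open Scope ring_scope.
Local Open Scope quotient_scope.

(* An element v of V is a vertex of the complex only when [set v] is a face. *)
Record scomplex (V : finType) := SComplex {
  faces :> {set {set V}};
  facesS : forall A B : {set V}, A \subset B -> B \in faces -> A \in faces
}.

Section Homology.
Variable V : finType.

(* The chains of all degrees at once: c S is the coefficient of the simplex S,
   oriented by the fixed total order enum_rank on V. *)
Definition chain : Type := {ffun {set V} -> int}.
HB.instance Definition _ := GRing.Zmodule.on chain.

Definition simplex (S : {set V}) : chain := [ffun T => (T == S)%:R].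

Definition vpos (S : {set V}) (v : V) : nat :=
  #|[set w in S | (enum_rank w < enum_rank v)%N]|.

(* d[v_0 < ... < v_k] = \sum_i (-1)^i [v_0, ..., v_(i-1), v_(i+1), ..., v_k];
   the boundary of a 0-simplex is the empty simplex (augmented complex). *)
Definition bd (c : chain) : chain :=
  \sum_(S : {set V})
    (\sum_(v in S) simplex (S :\ v) *~ ((-1) ^+ vpos S v)) *~ c S.

(* The oriented simplex [v_0, ..., v_(m-1)], for vertices given in any order. *)
Definition oriented_simplex (m : nat) (v : 'I_m -> V) : chain :=
  if injectiveb v then
    simplex [set v i | i : 'I_m] *~
      ((-1) ^+ #|[set p : 'I_m * 'I_m |
                  (p.1 < p.2)%N && (enum_rank (v p.2) < enum_rank (v p.1))%N]|)
  else 0.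

Definition support_faces (c : chain) : {set {set V}} := [set S | c S != 0].

Variable K : scomplex V.

(* Degrees are shifted by one: m counts vertices, so that m = 0 is the degree
   -1 of the augmented complex and rchains m is C_(m-1)(K). *)
Definition rchains (m : nat) : {pred chain} :=
  fun c => [forall S : {set V}, (c S != 0) ==> (S \in K) && (#|S| == m)].

Definition rcycles (m : nat) : {pred chain} :=
  fun c => (c \in rchains m) && (bd c == 0).

Lemma bd_is_zmod_morphism : zmod_morphism bd.
Proof.
move=> a b; rewrite /bd -sumrB; apply: eq_bigr => S _.
by rewrite !ffunE -mulrzBr.
Qed.
HB.instance Definition _ :=
  GRing.isZmodMorphism.Build chain chain bd bd_is_zmod_morphism.

Lemma rchains_zmod_closed m : zmod_closed (rchains m).
Proof.
split=> [|a b /forallP Ha /forallP Hb].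
  by apply/forallP => S; rewrite ffunE eqxx.
apply/forallP => S; apply/implyP; rewrite !ffunE.
have [a0|aN0] := eqVneq (a S) 0; last by move=> _; exact: (implyP (Ha S)).
rewrite a0 sub0r oppr_eq0; exact: (implyP (Hb S)).
Qed.
HB.instance Definition _ m :=
  GRing.isZmodClosed.Build chain (rchains m) (rchains_zmod_closed m).

Lemma rcycles_zmod_closed m : zmod_closed (rcycles m).
Proof.
split=> [|a b /andP[Ca /eqP da] /andP[Cb /eqP db]].
  by apply/andP; split; [exact: rpred0 | rewrite raddf0].
by apply/andP; split; [exact: rpredB | rewrite raddfB /= da db subrr].
Qed.
HB.instance Definition _ m :=
  GRing.isZmodClosed.Build chain (rcycles m) (rcycles_zmod_closed m).

Record rcycle (m : nat) := RCycle {
  rcycle_chain :> chain;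
  rcycleP : rcycle_chain \in rcycles m
}.
HB.instance Definition _ m := [isSub for @rcycle_chain m].
HB.instance Definition _ m := [Choice of rcycle m by <:].
HB.instance Definition _ m := [SubChoice_isSubZmodule of rcycle m by <:].

Definition rboundaries (m : nat) : {pred rcycle m} :=
  fun z => `[< exists2 c : chain, c \in rchains m.+1 & bd c = val z >].

Lemma rboundaries_zmod_closed m : zmod_closed (@rboundaries m).
Proof.
split=> [|a b /asboolP[c Cc dc] /asboolP[e Ce de]]; apply/asboolP.
  by exists 0; [exact: rpred0 | rewrite !raddf0].
by exists (c - e); [exact: rpredB | rewrite !raddfB /= dc de].
Qed.
HB.instance Definition _ m :=
  GRing.isZmodClosed.Build (rcycle m) (@rboundaries m)
    (@rboundaries_zmod_closed m).

(* rhomology m is the reduced homology group of K in degree m - 1. *)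
Definition rhomology (m : nat) : zmodType := Quotient.quot (@rboundaries m).

Definition hclass (m : nat) (z : rcycle m) : rhomology m :=
  \pi_(Quotient.quot (@rboundaries m)) z.

End Homology.

Definition is_Zbasis (I : finType) (M : zmodType) (b : I -> M) : Prop :=
  (forall a : I -> int, \sum_i b i *~ a i = 0 -> forall i, a i = 0) /\
  (forall y : M, exists a : I -> int, y = \sum_i b i *~ a i).

Section GeneratedComplex.
Variables (V : finType) (H : {set {set V}}).

Definition generated_faces : {set {set V}} :=
  [set A : {set V} | [exists B in H, A \subset B]].

Lemma generated_facesS (A B : {set V}) :
  A \subset B -> B \in generated_faces -> A \in generated_faces.
Proof.
rewrite !inE => sAB /existsP[C /andP[CH sBC]].
by apply/existsP; exists C; rewrite CH (subset_trans sAB).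
Qed.

Definition generated : scomplex V := SComplex generated_facesS.

End GeneratedComplex.

(* For points p i in convex position, the i in A index the vertices of a proper
   face of the convex hull: A is cut out by a supporting hyperplane. *)
Definition proper_polytope_face (R : realFieldType) (d : nat) (I : finType)
    (p : I -> 'rV[R]_d) (A : {set I}) : Prop :=
  A != [set: I] /\
  exists (l : 'cV[R]_d) (c : R),
    forall i, (p i *m l) 0 0 <= c ?= iff (i \in A).

Definition cross_polytope_vertex (R : realFieldType) (d : nat)
    (p : 'I_d * bool) : 'rV[R]_d :=
  if p.2 then delta_mx 0 p.1 else - delta_mx 0 p.1.

Definition iso_cross_polytope_boundary (R : realFieldType) (d : nat)
    (V : finType) (K : scomplex V) : Prop :=
  exists f : 'I_d * bool -> V, injective f /\
    forall B : {set V}, B \in K <->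
      exists2 A : {set 'I_d * bool},
        proper_polytope_face (@cross_polytope_vertex R d) A & B = f @: A.

Section PartialPartitions.
Variable n : nat.

Definition partial_partitions : {set {set {set 'I_n}}} :=
  [set P | trivIset P && (set0 \notin P)].

Lemma partial_partitionsS (P Q : {set {set 'I_n}}) :
  P \subset Q -> Q \in partial_partitions -> P \in partial_partitions.
Proof.
rewrite !inE => sPQ /andP[tQ nQ].
by rewrite (trivIsetS sPQ tQ) (contra (subsetP sPQ set0) nQ).
Qed.

Definition Dn : scomplex {set 'I_n} := SComplex partial_partitionsS.

Definition nonsingleton_partition (j : nat) : finType :=
  {F : {set {set 'I_n}} |
    [&& partition F [set: 'I_n], #|F| == j & [forall B in F, (2 <= #|B|)%N]]}.

Section SigmaF.
Variables (j : nat) (x : 'I_j -> {set 'I_n}) (s : 'I_j -> 'I_n).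

(* e i = true stands for epsilon_i = 1, and e i = false for epsilon_i = -1. *)
Definition HO_block (e : {ffun 'I_j -> bool}) (i : 'I_j) : {set 'I_n} :=
  if e i then x i else [set s i].

Definition HO : {set {set {set 'I_n}}} :=
  [set [set HO_block e i | i : 'I_j] | e : {ffun 'I_j -> bool}].

(* Coherent orientations: [x_1^e_1, ..., x_j^e_j] has sign e_1 ... e_j, i.e.
   sigma is the join of the 0-spheres [x_i] - [{s_i}]. *)
Definition sigma : chain {set 'I_n} :=
  \sum_(e : {ffun 'I_j -> bool})
    oriented_simplex (HO_block e) *~ (\prod_(i < j) (-1) ^+ (~~ e i)).

End SigmaF.
End PartialPartitions.

(* Main.v *)
Require Import Defs.
From mathcomp Require Import all_boot all_order all_algebra.
From mathcomp Require Import generic_quotient ring_quotient boolp ring lra zify.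

(** A face of [D_n] splits into its non-singleton blocks [N] and a set of
    singletons, which is an arbitrary subset of the points not covered by [N].
    A cycle whose part with the most non-singleton blocks vanishes wherever [N]
    covers [n] can therefore be pushed, by coning over an uncovered singleton
    [{a}], to fewer non-singleton blocks; iterating, it is a boundary.  The
    remaining faces, the partitions [F] without singletons, are facets, so the
    coefficient at [F] kills boundaries; and it is [+-1] on [sigma_F] and [0] on
    the other [sigma_G], as every other face of [sigma_G] has a singleton. *)

Set Implicit Arguments.
Unset Strict Implicit.
Unset Printing Implicit Defensive.

Import Order.TTheory GRing.Theory Num.Theory.

(** * Coefficients of the boundary map *)

Section BoundaryCoefficients.
Local Open Scope ring_scope.
Variable V : finType.
Implicit Types (c : chain V) (S T : {set V}) (v w : V).

(** Used also for [v] outside [T], where it is the incidence number of [T] in [v |: T]. *)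
Definition vsign T v : int := (-1) ^+ vpos T v.

Lemma vsign_sqr T v : vsign T v * vsign T v = 1.
Proof. by rewrite /vsign -expr2 sqrr_sign. Qed.

Lemma vposU1 T v w : w \notin T ->
  vpos (w |: T) v = ((enum_rank w < enum_rank v) + vpos T v)%N.
Proof.
move=> wT; rewrite /vpos; have [rw|rw] := boolP (enum_rank w < enum_rank v)%N.
  rewrite (_ : [set _ in _ | _] =
    w |: [set u in T | (enum_rank u < enum_rank v)%N]).
    by rewrite cardsU1 inE (negPf wT).
  by apply/setP=> u; rewrite !inE; case: eqP => // ->.
rewrite add0n; apply: eq_card => u; rewrite !inE; case: eqP => // ->.
by rewrite (negPf rw) !andbF.
Qed.

Lemma vsignU1_self T v : vsign (v |: T) v = vsign T v.
Proof.
rewrite /vsign /vpos; congr (_ ^+ _); apply: eq_card => u; rewrite !inE.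
by case: eqP => // ->; rewrite ltnn !andbF.
Qed.

(** Exactly one of [v] and [w] precedes the other, so inserting both shifts exactly one of the two
    positions. *)
Lemma vsign_swap T v w : v != w -> v \notin T -> w \notin T ->
  vsign (v |: T) w * vsign (w |: T) v = - (vsign T w * vsign T v).
Proof.
move=> vw vT wT; rewrite /vsign !vposU1 // !exprD.
have : enum_rank v != enum_rank w :> nat.
  by apply: contra vw => /eqP/val_inj/enum_rank_inj ->.
by case: ltngtP => //= _ _; rewrite expr0 expr1; ring.
Qed.

Lemma chain_mulrzE c (z : int) S : (c *~ z) S = z * c S.
Proof.
have natE k : (c *+ k) S = k%:R * c S by rewrite ffunMnE mulr_natl.
case: z => k; first by rewrite -pmulrn natE -natz.
by rewrite NegzE mulrNz ffunE -pmulrn natE -natz mulNr.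
Qed.

Lemma chain_combE (I : finType) (b : I -> chain V) (a : I -> int) S :
  (\sum_i b i *~ a i) S = \sum_i a i * b i S.
Proof. by rewrite sum_ffunE; apply: eq_bigr => i _; rewrite chain_mulrzE. Qed.

(** The boundary read from the receiving side: each simplex [S] of the defining sum that contributes
    at [T] is [v |: T] for a new vertex [v]. *)
Lemma bdE c T :
  bd c T = \sum_(v | v \notin T) vsign T v * c (v |: T).
Proof.
rewrite /bd sum_ffunE.
transitivity (\sum_(S : {set V}) \sum_(v in S)
   (if T == S :\ v then vsign S v * c S else 0)).
  apply: eq_bigr => S _; rewrite chain_mulrzE sum_ffunE mulr_sumr.
  apply: eq_bigr => v _; rewrite chain_mulrzE ffunE /vsign.
  by case: eqP => _; rewrite ?mulr1 ?mulr0 // mulrC.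
rewrite (exchange_big_dep predT) //= [RHS]big_mkcond; apply: eq_bigr => v _.
case: ifPn => [vT|vT].
  rewrite (bigD1 (v |: T)) ?setU11 //= setU1K // eqxx vsignU1_self.
  rewrite big1 ?addr0 // => S /andP[vS SvT]; case: eqP => // TS.
  by move: SvT; rewrite TS setD1K // eqxx.
rewrite big1 // => S vS; case: eqP => // TS.
by move: vT; rewrite TS !inE eqxx.
Qed.

Lemma bd_bd c : bd (bd c) = 0.
Proof.
apply/ffunP => T; rewrite bdE [RHS]ffunE.
set X := LHS.
have XE : X = \sum_v \sum_w (if [&& v != w, v \notin T & w \notin T] then
   vsign T v * vsign (v |: T) w * c (w |: (v |: T)) else 0).
  rewrite /X big_mkcond; apply: eq_bigr => v _; case: ifPn => vT; last first.
    by rewrite big1 // => w _; rewrite andbF.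
  rewrite bdE mulr_sumr big_mkcond; apply: eq_bigr => w _ /=.
  by rewrite !inE negb_or [w == v]eq_sym mulrA.
(* Exchanging the two inserted vertices negates each term, and the integers have no 2-torsion. *)
have : X = - X.
  rewrite {1}XE exchange_big XE -sumrN; apply: eq_bigr => v _.
  rewrite -sumrN; apply: eq_bigr => w _.
  rewrite eq_sym [(w \notin T) && _]andbC.
  case: ifPn => [/and3P[vw vT wT]|]; last by rewrite oppr0.
  rewrite setUCA -mulNr; congr (_ * _).
  have := vsign_swap vw vT wT; move: (vsign_sqr T v) (vsign_sqr T w).
  move: (vsign_sqr (v |: T) w).
  move: (vsign T v) (vsign T w) (vsign (v |: T) w) (vsign (w |: T) v).
  move=> a b d e d1 a1 b1 de.
  have -> : e = - (b * a * d) by rewrite -[LHS]mul1r -d1 -mulrA de; ring.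
  by rewrite mulrN !mulrA b1 mul1r.
move: X {XE} => X; lia.
Qed.

End BoundaryCoefficients.

(** * Chains, cycles and classes in reduced homology *)

Section ReducedChains.
Local Open Scope ring_scope.
Local Open Scope quotient_scope.
Variables (V : finType) (K : scomplex V).
Implicit Types c z : chain V.

Lemma rchainsP m c :
  reflect (forall S, c S != 0 -> S \in faces K /\ #|S| = m) (c \in rchains K m).
Proof.
apply: (iffP forallP) => h S.
  by move=> cS; move: (h S); rewrite cS => /andP[-> /eqP].
by apply/implyP => /h[-> ->]; rewrite /= eqxx.
Qed.

Lemma rchains_out m c S : c \in rchains K m -> S \notin faces K -> c S = 0.
Proof.
by move=> /rchainsP h; apply: contraNeq => /h[].
Qed.

Lemma bd_rchains m c : c \in rchains K m.+1 -> bd c \in rchains K m.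
Proof.
move=> /rchainsP h; apply/rchainsP => S; rewrite bdE.
have [/existsP[v /andP[vS cS]] _|/existsPn h0] :=
    boolP [exists v, (v \notin S) && (c (v |: S) != 0)]; last first.
  rewrite big1 ?eqxx // => v vS.
  by move: (h0 v); rewrite vS negbK => /eqP ->; rewrite mulr0.
have [KS] := h _ cS; rewrite cardsU1 vS => -[cardS]; split=> //.
by apply: facesS KS; rewrite subsetUr.
Qed.

Lemma bd_mem_rcycles m c : c \in rchains K m.+1 -> bd c \in rcycles K m.
Proof. by move=> h; apply/andP; rewrite bd_rchains ?bd_bd. Qed.

Lemma rcycles_rchains m z : z \in rcycles K m -> z \in rchains K m.
Proof. by case/andP. Qed.

Lemma rcycles_bd m z : z \in rcycles K m -> bd z = 0.
Proof. by case/andP => _ /eqP. Qed.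

Lemma hclass_eq0 m (z : rcycle K m) :
  hclass z = 0 <-> exists2 c, c \in rchains K m.+1 & bd c = z.
Proof.
have <- : (z \in @rboundaries V K m) <->
    exists2 c, c \in rchains K m.+1 & bd c = z.
  by split => [/asboolP|h]; last exact/asboolP.
(* Writing [z] as [z - 0] turns membership in the boundaries into congruence to 0 in the
   quotient. *)
rewrite -{2}[z]subr0 Quotient.idealrBE /hclass.
rewrite -[0 in X in X <-> _](raddf0 \pi_(Quotient.quot (@rboundaries V K m))).
by split => /eqP.
Qed.

Lemma hclass_sum m (I : finType) (b : I -> rcycle K m) (a : I -> int) :
  hclass (\sum_i b i *~ a i) = \sum_i hclass (b i) *~ a i.
Proof.
rewrite /hclass raddf_sum; apply: eq_bigr => i _; exact: raddfMz.
Qed.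

End ReducedChains.

(** * Coning cycles over a free singleton *)

Section ConeOverFreeSingleton.
Local Open Scope ring_scope.
Variable n : nat.
Implicit Types (S T : {set {set 'I_n}}) (v w : {set 'I_n}).
Implicit Types z : chain {set 'I_n}.

Lemma DnP T : reflect
  (set0 \notin T /\ {in T &, forall A B : {set _}, A != B -> [disjoint A & B]})
  (T \in faces (Dn n)).
Proof. by rewrite inE andbC; apply: (iffP andP) => -[-> /trivIsetP]. Qed.

Definition nonsingletons T := [set B in T | #|B| != 1%N].

Lemma nonsingletonsU1 T v : #|v| = 1%N ->
  nonsingletons (v |: T) = nonsingletons T.
Proof.
move=> v1; apply/setP => B; rewrite !inE; case: eqP => // ->.
by rewrite v1 eqxx !andbF.
Qed.

Lemma nonsingletonsD1 T v : #|v| = 1%N ->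
  nonsingletons (T :\ v) = nonsingletons T.
Proof.
move=> v1; apply/setP => B; rewrite !inE; case: eqP => // ->.
by rewrite v1 eqxx !andbF.
Qed.

Lemma card_nonsingletonsU1 T w : w \notin T -> #|w| != 1%N ->
  #|nonsingletons (w |: T)| = #|nonsingletons T|.+1.
Proof.
move=> wT w1.
rewrite (_ : nonsingletons _ = w |: nonsingletons T) ?cardsU1.
  by rewrite inE (negPf wT).
by apply/setP => B; rewrite !inE; case: eqP => // ->.
Qed.

(** A singleton block would lie inside the non-singleton block that covers its point, against
    disjointness. *)
Lemma nonsingletons_full T : T \in faces (Dn n) ->
  cover (nonsingletons T) = setT -> nonsingletons T = T.
Proof.
move=> /DnP[T0 disjT] covT; apply/setP => B; rewrite inE andb_idr // => BT.
apply/negP => /cards1P[a Ba].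
have /bigcupP[C] : a \in cover (nonsingletons T) by rewrite covT inE.
rewrite inE => /andP[CT C1] aC; have CB : B != C.
  by apply: contraNneq C1 => <-; rewrite Ba cards1.
by move: (disjT B C BT CT CB); rewrite Ba disjoints1 aC.
Qed.

(** A coface of [T] would need one more nonempty block, and no point is left for it. *)
Lemma bd_full m z T : z \in rchains (Dn n) m -> cover T = setT -> bd z T = 0.
Proof.
move=> zK covT; rewrite bdE big1 // => w wT; rewrite (rchains_out zK) ?mulr0 //.
apply/negP => /DnP[]; rewrite !inE negb_or => /andP[w0 _] disj.
have /set0Pn[a aw] : w != set0 by rewrite eq_sym.
have /bigcupP[C CT aC] : a \in cover T by rewrite covT inE.
have wC : w != C by apply: contraNneq wT => ->.
have := disj w C; rewrite !inE eqxx CT orbT => /(_ isT isT wC).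
by move=> /disjoint_setI0/setP/(_ a); rewrite !inE aw aC.
Qed.

(** The choice depends only on the non-singleton blocks, so faces that differ by singletons share
    the same apex. *)
Definition free_point T := [pick a | a \notin cover (nonsingletons T)].

(** The join with the apex [[set a]], given by coefficients; faces of [z] that already contain the
    apex contribute nothing. *)
Definition cone z : chain {set 'I_n} :=
  [ffun S => if free_point S is Some a then
     (if [set a] \in S then vsign S [set a] * z (S :\ [set a]) else 0)
   else 0].

(** The apex is disjoint from the non-singleton blocks because its point is uncovered, and from the
    other singletons because they differ from it. *)
Lemma cone_rchains m z :
  z \in rchains (Dn n) m -> cone z \in rchains (Dn n) m.+1.
Proof.
move=> /rchainsP zK; apply/rchainsP => S; rewrite ffunE /free_point.
case: pickP => [a aS|_]; last by rewrite eqxx.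
case: ifPn => [aSS|_]; last by rewrite eqxx.
rewrite mulf_eq0 negb_or => /andP[_] /zK[]; set A := [set a].
move=> /DnP[S0 disjS] cardS; split; last by rewrite (cardsD1 A) aSS cardS.
have A0 : set0 != A by apply/eqP => /setP/(_ a); rewrite !inE eqxx.
have disjA B : B \in S -> B != A -> a \notin B.
  move=> BS BA; have [/cards1P[b Bb]|B1] := boolP (#|B| == 1%N).
    by rewrite Bb inE; apply: contraNneq BA => ab; rewrite Bb -ab.
  by apply: contra aS => aB; apply/bigcupP; exists B; rewrite // inE BS.
apply/DnP; split; first by move: S0; rewrite !inE A0.
move=> B C BS CS BC.
have [BA|BA] := eqVneq B A.
  by rewrite BA disjoints1 disjA // -BA eq_sym.
have [CA|CA] := eqVneq C A; first by rewrite CA disjoint_sym disjoints1 disjA.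
by apply: disjS; rewrite // !inE ?BA ?CA.
Qed.

(** On the top layer of [z] only singletons can be added to [T] with effect; there the apex is
    constant and [cone] behaves as a contracting homotopy. *)
Lemma bd_cone p z T :
  bd z = 0 -> (forall S, (p < #|nonsingletons S|)%N -> z S = 0) ->
  #|nonsingletons T| = p -> cover (nonsingletons T) != setT ->
  bd (cone z) T = z T.
Proof.
move=> dz zp Tp covT.
have [a aT fT] : exists2 a, a \notin cover (nonsingletons T) &
    free_point T = Some a.
  rewrite /free_point; case: pickP => [a aT|h]; first by exists a.
  case/negP: covT; apply/eqP/setP => a; rewrite inE.
  exact: negbFE (h a).
set v := [set a].
have v1 : #|v| = 1%N by rewrite cards1.
(* A new non-singleton block raises the count above [p], where [z] vanishes; deleting a singleton
   does not lower it. *)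
have zw w : w \notin T -> #|w| != 1%N -> forall u : {set _}, #|u| = 1%N ->
    z ((w |: T) :\ u) = 0.
  move=> wT w1 u u1.
  by rewrite zp // nonsingletonsD1 // card_nonsingletonsU1 // Tp.
have coneE w : w \notin T -> cone z (w |: T) =
    if v \in w |: T then vsign (w |: T) v * z ((w |: T) :\ v) else 0.
  move=> wT; rewrite ffunE; have [w1|w1] := boolP (#|w| == 1%N).
    by rewrite /free_point nonsingletonsU1 ?(eqP w1) // -/(free_point T) fT.
  rewrite [z (_ :\ v)]zw // mulr0 if_same.
  by case: free_point => // b; rewrite zw ?cards1 // mulr0 if_same.
(* If the apex is not in [T], only the coface adding it survives, and its two signs cancel. *)
rewrite bdE; have [vT|vT] := boolP (v \in T); last first.
  rewrite (bigD1 v) //= coneE // setU11 setU1K // vsignU1_self mulrA vsign_sqr.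
  rewrite mul1r big1 ?addr0 // => w /andP[wT wv].
  by rewrite coneE // !inE eq_sym (negPf wv) (negPf vT) mulr0.
pose T' := T :\ v; have TE : T = v |: T' by rewrite setD1K.
have vT' : v \notin T' by rewrite !inE eqxx.
(* If the apex is in [T], the cycle equation at [T] without the apex is solved for [z T], then
   matched term by term. *)
have /ffunP/(_ T') := dz; rewrite bdE ffunE (bigD1 v) //= -TE.
move=> /(canRL (addrK _)); rewrite sub0r => /(congr1 (fun u => vsign T' v * u)).
rewrite mulrA vsign_sqr mul1r => ->; rewrite -sumrN mulr_sumr.
rewrite (eq_bigl (fun w => (w \notin T') && (w != v))); last first.
  by move=> w; rewrite TE inE negb_or andbC !inE.
apply: eq_bigr => w /andP[wT' wv].
have wT : w \notin T by rewrite TE inE negb_or inE wv.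
have -> : cone z (w |: T) = vsign (w |: T') v * z (w |: T').
  rewrite coneE // !inE vT orbT.
  have -> : (w |: T) :\ v = w |: T'.
    by rewrite TE setUCA setU1K // in_setU1 negb_or eq_sym wv.
  by rewrite TE setUCA vsignU1_self.
have := vsign_swap wv wT' vT'; rewrite -TE => swap.
by rewrite mulrA [vsign T w * _]mulrC swap; ring.
Qed.

(** Induction on a strict upper bound [p] for the number of non-singleton blocks in the support:
    subtracting [bd (cone z)] clears the top layer. *)
Lemma rcycle_boundary m z : z \in rcycles (Dn n) m ->
  (forall T, T \in faces (Dn n) -> cover (nonsingletons T) = setT -> z T = 0) ->
  exists2 c, c \in rchains (Dn n) m.+1 & bd c = z.
Proof.
move=> zZ z0; pose p := #|{: {set 'I_n}}|.+1.
have: forall S, (p <= #|nonsingletons S|)%N -> z S = 0.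
  by move=> S; rewrite ltnNge max_card.
elim: p z zZ z0 => [|p IHp] z zZ z0 zp.
  exists 0; rewrite ?rpred0 ?raddf0 //.
  by apply/ffunP => S; rewrite zp // ffunE.
have zK := rcycles_rchains zZ; have cK := cone_rchains zK.
have [||S pS|c Kc dc] := IHp (z - bd (cone z)).
- by rewrite rpredB // bd_mem_rcycles.
(* At a face fully covered by non-singleton blocks both [z] and every boundary vanish, so the
   hypothesis persists. *)
- move=> T KT covT; rewrite !ffunE z0 // (bd_full cK) ?subrr //.
  by rewrite -(nonsingletons_full KT covT).
- have bdK := bd_rchains cK.
  have [/eqP covT|covT] := boolP (cover (nonsingletons S) == setT).
    have [KS|KS] := boolP (S \in faces (Dn n)); last first.
      by rewrite !ffunE (rchains_out zK KS) (rchains_out bdK KS) subrr.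
    rewrite !ffunE z0 // (bd_full cK) ?subrr //.
    by rewrite -(nonsingletons_full KS covT).
  rewrite !ffunE; move: pS; rewrite leq_eqVlt => /orP[/eqP pS|pS].
    by rewrite (@bd_cone p) ?subrr // (rcycles_bd zZ).
  (* Above layer [p], [bd_cone] applies at the layer of [S] itself, so the correction creates
     nothing there. *)
  rewrite (@bd_cone #|nonsingletons S|) ?subrr //; first exact: rcycles_bd zZ.
  by move=> S' h; apply: zp; apply: ltn_trans h.
by exists (c + cone z); rewrite ?rpredD // raddfD /= dc subrK.
Qed.

End ConeOverFreeSingleton.

(** * Boundary of a simplex whose vertices come in any order *)

Section OrientedSimplices.
Local Open Scope ring_scope.
Variable V : finType.

Lemma bd_simplex (S : {set V}) :
  bd (simplex S) = \sum_(u in S) simplex (S :\ u) *~ vsign S u.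
Proof.
rewrite /bd (bigD1 S) //= ffunE eqxx mulr1z [X in _ + X]big1 ?addr0 // => T TS.
by rewrite ffunE (negPf TS) mulr0z.
Qed.

Variable m : nat.
Implicit Types (v : 'I_m -> V) (i : 'I_m).

Definition inversions v := [set p : 'I_m * 'I_m |
  (p.1 < p.2)%N && (enum_rank (v p.2) < enum_rank (v p.1))%N].

(** The inversions of the sequence with entry [i] deleted, kept on the original indices; they do not
    depend on [v i]. *)
Definition inversions_off v i :=
  [set p in inversions v | (p.1 != i) && (p.2 != i)].

Let card_sum (T : finType) (P : pred T) : #|[set t | P t]| = (\sum_t P t)%N.
Proof.
rewrite -sum1_card big_mkcond; apply: eq_bigr => t _.
by rewrite inE; case: (P t).
Qed.

(* Mod 2, the inversions involving i and the vertices below v i add up to the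
   number of positions before i: a k < i is counted exactly once, a k > i either
   twice or not at all. *)
Lemma inversions_vsign v i : injective v ->
  (-1) ^+ #|inversions v| * vsign [set v k | k : 'I_m] (v i) =
  (-1) ^+ (#|inversions_off v i| + i) :> int.
Proof.
move=> vI; pose r k : nat := enum_rank (v k).
have rI : injective r by move=> a b /val_inj/enum_rank_inj/vI.
pose f (a b : 'I_m) : bool := (a < b)%N && (r b < r a)%N.
have invE : #|inversions v| = (\sum_a \sum_b f a b)%N.
  by rewrite card_sum pair_big.
have offE : #|inversions_off v i| =
    (\sum_(a | a != i) \sum_(b | b != i) f a b)%N.
  rewrite /inversions_off card_sum pair_big big_mkcond [RHS]big_mkcond /=.
  by apply: eq_bigr => -[a b] _; rewrite inE /= andbC; case: ifP.
have posE : vpos [set v k | k : 'I_m] (v i) = (\sum_k (r k < r i))%N.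
  rewrite -card_sum /vpos -(card_imset _ vI); apply: eq_card => w.
  rewrite inE; apply/andP/imsetP => [[/imsetP[k _ ->] h]|[k]].
    by exists k; rewrite ?inE.
  by rewrite inE => h ->; rewrite imset_f.
have iE : nat_of_ord i = (\sum_(k : 'I_m) (k < i))%N.
  rewrite -[LHS]card_ord -sum1_card (big_ord_widen m (fun=> 1%N)) //;
    last exact: ltnW.
  by rewrite big_mkcond; apply: eq_bigr => k _; case: (_ < _)%N.
have fii : f i i = false by rewrite /f ltnn.
have splitE : (\sum_a \sum_b f a b =
    \sum_b (f i b + f b i) + #|inversions_off v i|)%N.
  rewrite (bigD1 i) //= big_split /= -addnA; congr (_ + _)%N.
  rewrite offE [X in (_ = X + _)%N](bigD1 i) //= fii add0n -big_split /=.
  by apply: eq_bigr => a _; rewrite (bigD1 i).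
have key : (\sum_b (f i b + f b i) + \sum_k (r k < r i) =
    (\sum_b f i b).*2 + \sum_(k : 'I_m) (k < i))%N.
  rewrite -addnn -!big_split /=; apply: eq_bigr => k _; rewrite /f.
  have [ki|ik|/val_inj ->] := ltngtP k i; last by rewrite ltnn.
  - have : r k != r i by apply: contraTneq ki => /rI ->; rewrite ltnn.
    by case: ltngtP.
  - by rewrite /= addn0; case: (_ < _)%N.
rewrite /vsign -exprD invE splitE posE addnAC key -iE -addnA.
by rewrite -mul2n exprD exprM sqrrN !expr1n mul1r addnC.
Qed.

(** The usual alternating formula: the sign is [(-1) ^+ i] times the orientation sign of the
    sequence without entry [i]. *)
Lemma bd_oriented_simplex v : injective v ->
  bd (oriented_simplex v) = \sum_(i < m)
    simplex ([set v k | k : 'I_m] :\ v i) *~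
      ((-1) ^+ (#|inversions_off v i| + i)).
Proof.
move=> vI; rewrite /oriented_simplex (introT (injectiveP _) vI) raddfMz /=.
rewrite bd_simplex big_imset /=; last by move=> a b _ _ /vI.
rewrite mulrz_suml; apply: eq_bigr => i _.
by rewrite -mulrzA -(inversions_vsign i vI) mulrC.
Qed.

End OrientedSimplices.

(** * The chain attached to a partition is a cycle *)

Section SigmaCycle.
Local Open Scope ring_scope.
Variables (n j : nat) (x : 'I_j -> {set 'I_n}) (s : 'I_j -> 'I_n).
Hypothesis disjx : forall i k, i != k -> [disjoint x i & x k].
Hypothesis cardx : forall i, (1 < #|x i|)%N.
Hypothesis sx : forall i, s i \in x i.
Implicit Types (e : {ffun 'I_j -> bool}) (i k : 'I_j).

(** Indexed like the vertices of the cross-polytope, with [x i] and [[set s i]] as an antipodal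
    pair. *)
Definition block_or_point (p : 'I_j * bool) : {set 'I_n} :=
  if p.2 then x p.1 else [set s p.1].

Lemma mem_block_or_point p : s p.1 \in block_or_point p.
Proof. by rewrite /block_or_point; case: p.2; rewrite ?inE. Qed.

Lemma sub_block_or_point p : block_or_point p \subset x p.1.
Proof. by rewrite /block_or_point; case: p.2; rewrite // sub1set. Qed.

Lemma disjoint_block_or_point p q : p.1 != q.1 ->
  [disjoint block_or_point p & block_or_point q].
Proof.
move=> /disjx; apply: disjointW; exact: sub_block_or_point.
Qed.

Lemma card_block_or_point p : (#|block_or_point p| == 1%N) = ~~ p.2.
Proof.
rewrite /block_or_point; case: p => i [] /=; last by rewrite cards1.
by apply/negbTE; rewrite neq_ltn cardx orbT.
Qed.

(** Size separates the two members of a pair, and disjointness separates different pairs. *)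
Lemma block_or_point_inj : injective block_or_point.
Proof.
move=> [i b] [k c] eq_bc; have := card_block_or_point (i, b).
rewrite eq_bc card_block_or_point /= => /negb_inj <-.
congr (_, _); apply/eqP; apply: contraT => ik.
have := @disjoint_block_or_point (i, b) (k, c) ik.
move=> /disjoint_setI0/setP/(_ (s i)); rewrite -eq_bc setIid inE => /negP[].
exact: (mem_block_or_point (i, _)).
Qed.

Definition HO_face e : {set {set 'I_n}} := [set HO_block x s e i | i : 'I_j].

Lemma HO_block_inj e : injective (HO_block x s e).
Proof. by move=> i k /(@block_or_point_inj (i, e i) (k, e k)) []. Qed.

Lemma mem_HO_face e p : (block_or_point p \in HO_face e) = (e p.1 == p.2).
Proof.
apply/imsetP/eqP => [[i _ /(@block_or_point_inj p (i, e i)) ->] //|ep].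
by exists p.1 => //; rewrite /HO_block ep; case: p {ep}.
Qed.

Lemma HO_face_inj : injective HO_face.
Proof.
move=> e e' eqe; apply/ffunP => i; apply/eqP.
by rewrite eq_sym -(mem_HO_face e' (i, e i)) -eqe mem_HO_face.
Qed.

Lemma HO_face_Dn e : HO_face e \in faces (Dn n).
Proof.
apply/DnP; split=> [|_ _ /imsetP[i _ ->] /imsetP[k _ ->] ik].
  apply/imsetP => -[i _ /setP/(_ (s i))].
  by rewrite inE (mem_block_or_point (i, e i)).
apply: (@disjoint_block_or_point (i, e i) (k, e k)).
by apply: contraNneq ik => /= ->.
Qed.

Lemma card_HO_face e : #|HO_face e| = j.
Proof. by rewrite (card_imset _ (@HO_block_inj e)) card_ord. Qed.

Definition HO_sign e : int := \prod_(i < j) (-1) ^+ (~~ e i).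

(** The sign passing to the fixed order of the vertices, times the product of the epsilons. *)
Definition HO_coef e : int :=
  (-1) ^+ #|inversions (HO_block x s e)| * HO_sign e.

Lemma norm_HO_coef e : `|HO_coef e| = 1.
Proof. by rewrite /HO_coef /HO_sign prodrXr -exprD normrX normrN1 expr1n. Qed.

Lemma sigmaE : sigma x s = \sum_e simplex (HO_face e) *~ HO_coef e.
Proof.
apply: eq_bigr => e _; rewrite /oriented_simplex.
by rewrite (introT (injectiveP _) (@HO_block_inj e)) -mulrzA.
Qed.

(** Distinct choices [e] give distinct faces, so no terms of the sum merge. *)
Lemma sigma_HO_face e : sigma x s (HO_face e) = HO_coef e.
Proof.
rewrite sigmaE sum_ffunE (bigD1 e) //= chain_mulrzE ffunE eqxx mulr1.
rewrite big1 ?addr0 // => e' e'e; rewrite chain_mulrzE ffunE.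
by rewrite (inj_eq HO_face_inj) eq_sym (negPf e'e) mulr0.
Qed.

Lemma sigma_out S : S \notin HO x s -> sigma x s S = 0.
Proof.
move=> SH; rewrite sigmaE sum_ffunE big1 // => e _; rewrite chain_mulrzE ffunE.
by case: eqP => [Se|]; rewrite ?mulr0 //; case/imsetP: SH; exists e.
Qed.

Lemma norm_sigma S : S \in HO x s -> `|sigma x s S| = 1.
Proof. by case/imsetP => e _ ->; rewrite sigma_HO_face norm_HO_coef. Qed.

Lemma support_sigma : support_faces (sigma x s) = HO x s.
Proof.
apply/setP => S; rewrite inE; apply/idP/idP.
  by apply: contraNT => /sigma_out ->.
by move=> /norm_sigma S1; rewrite -normr_eq0 S1.
Qed.

Let flip i e : {ffun 'I_j -> bool} := [ffun k => (k == i) (+) e k].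

Let flipK i : involutive (flip i).
Proof. by move=> e; apply/ffunP => k; rewrite !ffunE addbA addbb. Qed.

Let flip_off i e k : k != i -> HO_block x s (flip i e) k = HO_block x s e k.
Proof. by move=> ki; rewrite /HO_block ffunE (negPf ki). Qed.

Lemma HO_faceD1 e i :
  HO_face e :\ HO_block x s e i = HO_block x s e @: [set~ i].
Proof.
apply/setP => B; rewrite !inE; apply/andP/imsetP => [[Bi /imsetP[k _ BE]]|].
  by exists k => //; rewrite !inE; apply: contraNneq Bi => <-; rewrite BE.
move=> [k]; rewrite !inE => ki ->; rewrite (inj_eq (@HO_block_inj e)) ki.
by rewrite imset_f.
Qed.

Lemma bd_sigma : bd (sigma x s) = 0.
Proof.
pose G i e := simplex (HO_face e :\ HO_block x s e i) *~
  ((-1) ^+ (#|inversions_off (HO_block x s e) i| + i) * HO_sign e).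
have -> : bd (sigma x s) = \sum_(i < j) \sum_e G i e.
  rewrite exchange_big raddf_sum; apply: eq_bigr => e _.
  rewrite raddfMz /= bd_oriented_simplex; last exact: HO_block_inj.
  by rewrite mulrz_suml; apply: eq_bigr => i _; rewrite -mulrzA.
apply: big1 => i _.
(* Once vertex [i] is deleted, [e] and [flip i e] leave the same face with the same inversions; only
   the epsilon product changes sign. *)
have Gflip e : G i (flip i e) = - G i e.
  rewrite /G -mulrNz -mulrN !HO_faceD1; congr (simplex _ *~ (_ ^+ (_ + _) * _)).
  - by apply: eq_in_imset => k; rewrite !inE => ki; rewrite flip_off.
  - apply: eq_card => -[a b]; rewrite !inE /=.
    case: (eqVneq a i) => [|ai]; first by rewrite !andbF.
    case: (eqVneq b i) => [|bi]; first by rewrite !andbF.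
    by rewrite !flip_off.
  - rewrite /HO_sign (bigD1 i) //= [in RHS](bigD1 i) //= -mulNr; congr (_ * _).
      by rewrite ffunE eqxx; case: (e i).
    by apply: eq_bigr => k ki; rewrite ffunE (negPf ki).
apply/ffunP => T; set X := \sum_e _; rewrite [RHS]ffunE.
have : X = - X.
  rewrite {1}/X (reindex_inj (inv_inj (flipK i))) -sumrN.
  by apply: eq_bigr => e _; rewrite Gflip.
move=> /ffunP/(_ T); rewrite ffunE; move: (X T) => y; lia.
Qed.

Lemma sigma_rcycles : sigma x s \in rcycles (Dn n) j.
Proof.
apply/andP; split; last by rewrite bd_sigma.
apply/rchainsP => S.
have [/imsetP[e _ ->] _|/sigma_out ->] := boolP (S \in HO x s).
  by rewrite HO_face_Dn card_HO_face.
by rewrite eqxx.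
Qed.

(** Each choice of a point [s i] creates a singleton, so every epsilon must be 1. *)
Lemma HO_no_singleton S : S \in HO x s ->
  {in S, forall B : {set _}, #|B| != 1%N} ->
  S = [set x i | i : 'I_j].
Proof.
case/imsetP => e _ -> noS; apply: eq_imset => i; rewrite /HO_block.
have /noS : HO_block x s e i \in HO_face e by apply: imset_f.
by rewrite (card_block_or_point (i, e i)) negbK /= => ->.
Qed.

Lemma blocks_HO : [set x i | i : 'I_j] \in HO x s.
Proof.
apply/imsetP; exists [ffun=> true] => //.
by apply: eq_imset => i; rewrite /HO_block ffunE.
Qed.

End SigmaCycle.

(** * Faces of the cross-polytope and the complex generated by the cycle *)

Section CrossPolytope.
Local Open Scope ring_scope.

Lemma cross_polytope_vertex_mul (R : realFieldType) (d : nat) (l : 'cV[R]_d) p :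
  (cross_polytope_vertex R p *m l) 0 0 = if p.2 then l p.1 0 else - l p.1 0.
Proof.
by rewrite /cross_polytope_vertex; case: p.2; rewrite ?mulNmx -rowE !mxE.
Qed.

(** An antipodal pair on a supporting hyperplane forces [c = 0], then [l = 0], so that the face is
    everything. *)
Lemma cross_polytope_faceP (R : realFieldType) (d : nat)
    (A : {set 'I_d * bool}) : (0 < d)%N ->
  proper_polytope_face (@cross_polytope_vertex R d) A <->
  forall i, ~~ (((i, true) \in A) && ((i, false) \in A)).
Proof.
move=> d0; split=> [[AT [l [c lc]]] i|noA].
  apply/negP => /andP[At Af].
  have lP k b : (if b then l k 0 else - l k 0) <= c ?= iff ((k, b) \in A).
    by rewrite -(cross_polytope_vertex_mul l (k, b)).
  have /eqP lt : l i 0 == c by rewrite (lP i true).2.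
  have /eqP lf : - l i 0 == c by rewrite (lP i false).2.
  have c0 : c = 0 by lra.
  have l0 k : l k 0 = 0.
    by have := (lP k true).1; have := (lP k false).1; rewrite c0; lra.
  case/negP: AT; apply/eqP/setP => -[k b]; rewrite inE -(lP k b).2 l0 c0 oppr0.
  by rewrite if_same eqxx.
split.
  apply/negP => /eqP AT; move: (noA (Ordinal d0)).
  by rewrite AT !inE.
(* The functional has entry 1 or -1 according to the vertex chosen from pair [i], and 0 if none is;
   it reaches 1 exactly on [A]. *)
exists (\col_i (((i, true) \in A)%:R - ((i, false) \in A)%:R)), 1 => -[i b].
rewrite cross_polytope_vertex_mul /= mxE.
move: (noA i); case: b; case: (_ \in A); case: (_ \in A) => //= _;
  apply/leifP; rewrite /= ?subr0 ?sub0r ?opprK ?oppr0 ?eqxx //; lra.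
Qed.

Lemma iso_cross_polytope_sigma (R : realFieldType) (n j : nat)
    (x : 'I_j -> {set 'I_n}) (s : 'I_j -> 'I_n) :
  (0 < j)%N -> (forall i k, i != k -> [disjoint x i & x k]) ->
  (forall i, (1 < #|x i|)%N) -> (forall i, s i \in x i) ->
  iso_cross_polytope_boundary R j (generated (support_faces (sigma x s))).
Proof.
move=> j0 disjx cardx sx; rewrite support_sigma //.
pose f := block_or_point x s.
have fI : injective f by apply: block_or_point_inj.
exists f; split=> // B; split=> [|[A /(cross_polytope_faceP _ _ j0) noA ->]].
  rewrite inE => /existsP[_ /andP[/imsetP[e _ ->] sBe]].
  exists (f @^-1: B).
    apply/cross_polytope_faceP => // i; rewrite !inE; apply/negP => /andP[].
    move=> /(subsetP sBe) ft /(subsetP sBe) ff; move: ft ff.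
    by rewrite !(mem_HO_face disjx cardx sx) /=; case: (e i).
  apply/setP => C; apply/idP/imsetP => [CB|[p]]; last by rewrite inE => h ->.
  have /imsetP[i _ CE] := subsetP sBe C CB.
  by exists (i, e i) => //; rewrite inE -[f _]CE.
(* Any set without antipodal pairs extends to a facet; pairs it does not meet are completed by the
   point. *)
rewrite inE; pose e : {ffun 'I_j -> bool} := [ffun i => (i, true) \in A].
apply/existsP; exists (HO_face x s e); rewrite imset_f //=.
apply/subsetP => _ /imsetP[[i b] iA ->].
rewrite (mem_HO_face disjx cardx sx) ffunE /=.
by move: (noA i); case: b iA => ->; rewrite ?andbT // => /negbTE ->.
Qed.

End CrossPolytope.

(** * Partitions without singleton blocks *)

Section NonsingletonPartitions.
Local Open Scope ring_scope.
Variables (n j : nat).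
Implicit Type F : nonsingleton_partition n j.

Lemma nonsingleton_partition_card F (B : {set 'I_n}) :
  B \in val F -> (1 < #|B|)%N.
Proof. by case/and3P: (valP F) => _ _ /forall_inP; apply. Qed.

Lemma nonsingleton_partition_cover F : cover (val F) = setT.
Proof. by case/and3P: (valP F) => /cover_partition. Qed.

Lemma nonsingleton_partition_full T : T \in faces (Dn n) -> #|T| = j ->
  cover (nonsingletons T) = setT -> exists F, T = val F.
Proof.
move=> KT cardT covT; have nT := nonsingletons_full KT covT.
suff h : [&& partition T setT, #|T| == j & [forall B in T, (2 <= #|B|)%N]].
  by exists (Sub T h); rewrite SubK.
move: (KT); rewrite inE => /andP[trivT T0].
rewrite /partition -{1}nT covT eqxx trivT T0 cardT eqxx /=.
apply/forall_inP => B BT; rewrite ltn_neqAle card_gt0.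
have -> : B != set0 by apply: contraNneq T0 => <-.
by move: BT; rewrite -{1}nT inE eq_sym => /andP[_ ->].
Qed.

Variables (x : 'I_j -> {set 'I_n}) (F : nonsingleton_partition n j).
Hypothesis hx : [set x i | i : 'I_j] = val F.

Lemma enum_blocks_card i : (1 < #|x i|)%N.
Proof. by apply: (@nonsingleton_partition_card F); rewrite -hx imset_f. Qed.

Lemma enum_blocks_disjoint i k : i != k -> [disjoint x i & x k].
Proof.
have /and3P[partF /eqP cardF _] := valP F.
(* The [j] indices enumerate exactly [j] blocks, so the enumeration is injective. *)
have /imset_injP xI : #|x @: 'I_j| == #|'I_j| by rewrite hx cardF card_ord.
move=> ik; apply: (trivIsetP (partition_trivIset partF)).
- by rewrite -hx imset_f.
- by rewrite -hx imset_f.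
- by apply: contraNneq ik => /xI ->.
Qed.

End NonsingletonPartitions.

(** * A basis of homology, detected by coefficients at singleton-free partitions *)

Theorem theorem3p5 (R : realFieldType) (n j : nat) (hj : 1 <= j <= n)
    (x : nonsingleton_partition n j -> 'I_j -> {set 'I_n})
    (hx : forall F, [set x F i | i : 'I_j] = val F)
    (s : nonsingleton_partition n j -> 'I_j -> 'I_n)
    (hs : forall F i, s F i \in x F i) :
  exists hcycle : forall F, sigma (x F) (s F) \in rcycles (Dn n) j,
    (forall F,
      [/\ support_faces (sigma (x F) (s F)) = HO (x F) (s F),
          forall S, S \in HO (x F) (s F) ->
            (`|sigma (x F) (s F) S| = 1 :> int)%R
        & iso_cross_polytope_boundary R j
            (generated (support_faces (sigma (x F) (s F))))]) /\
    is_Zbasis (fun F : nonsingleton_partition n j =>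
                 hclass (RCycle (hcycle F))).
Proof.
have j0 : (0 < j)%N by case/andP: hj.
have disjx F := enum_blocks_disjoint (hx F).
have cardx F := enum_blocks_card (hx F).
have hcycle F := sigma_rcycles (disjx F) (cardx F) (hs F).
exists hcycle; split=> [F|].
  split; first exact: (support_sigma (disjx F) (cardx F) (hs F)).
    exact: (norm_sigma (disjx F) (cardx F) (hs F)).
  exact: (iso_cross_polytope_sigma R j0 (disjx F) (cardx F) (hs F)).
(* The diagonal coefficient is a sign, hence its own inverse over the integers. *)
have sigma_diag F :
    (sigma (x F) (s F) (val F) * sigma (x F) (s F) (val F) = 1)%R.
  have := norm_sigma (disjx F) (cardx F) (hs F) (blocks_HO (x F) (s F)).
  by rewrite hx -expr2 -(real_normK (num_real _)) => ->; rewrite expr1n.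
have sigma_off F G : F != G -> sigma (x F) (s F) (val G) = 0%R.
  move=> FG; apply: (sigma_out (disjx F) (cardx F) (hs F)); apply/negP => GF.
  case/negP: FG; apply/eqP/val_inj; rewrite -hx; apply/esym.
  apply: (HO_no_singleton (cardx F) GF) => B /nonsingleton_partition_card.
  by rewrite neq_ltn => ->; rewrite orbT.
pose comb (a : nonsingleton_partition n j -> int) : rcycle (Dn n) j :=
  (\sum_F RCycle (hcycle F) *~ a F)%R.
have combE a G : (val (comb a) (val G) = a G * sigma (x G) (s G) (val G))%R.
  have -> : val (comb a) = (\sum_F sigma (x F) (s F) *~ a F)%R.
    by rewrite raddf_sum; apply: eq_bigr => F _; exact: raddfMz.
  rewrite chain_combE (bigD1 G) // big1 => [|F FG]; first exact: addr0.
  by rewrite sigma_off // mulr0.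
split=> [a|y].
  (* Independence: a combination that bounds has coefficient 0 at each facet [val G], and that
     coefficient is [a G] up to sign. *)
  rewrite -hclass_sum => /hclass_eq0[c Kc dc] G.
  have := combE a G; rewrite -[val (comb a)]dc (bd_full Kc); last first.
    exact: nonsingleton_partition_cover.
  move=> /(congr1 (fun u => u * sigma (x G) (s G) (val G))%R).
  by rewrite mul0r -mulrA sigma_diag mulr1.
pose z : rcycle (Dn n) j := repr y.
have yE : y = hclass z by rewrite /hclass reprK.
(* Chosen so that the combination agrees with [z] at every singleton-free partition; the difference
   is then a boundary. *)
pose a F := (val z (val F) * sigma (x F) (s F) (val F))%R.
exists a; rewrite -hclass_sum yE -/(comb a); apply/eqP; rewrite -subr_eq0.
rewrite -raddfB; apply/eqP/hclass_eq0.
have wZ := rcycleP (z - comb a)%R; apply: rcycle_boundary => // T KT covT.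
have [cardT|cardT] := eqVneq #|T| j; last first.
  apply: contraNeq cardT => wT.
  by have [_ ->] := rchainsP _ _ _ (rcycles_rchains wZ) T wT.
have [F ->] := nonsingleton_partition_full KT cardT covT.
transitivity (val z (val F) - val (comb a) (val F))%R.
  by rewrite [rcycle_chain _](raddfB val) !ffunE.
by rewrite combE -mulrA sigma_diag mulr1 subrr.
Qed.
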